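(* Let $n\ge 1$, $N=2^n$, and let $H$ be the $N\times N$ symmetric Toeplitz matrix with entries $H_{i,j}=a_{|i-j|}$ (indices $i,j\in\{0,\dots,N-1\}$). For $1\le k\le N-1$ define \[ M_k = a_k \sum_{i=0}^{N-1-k} \big(\ket{i}\bra{i+k} + \ket{i+k}\bra{i}\big). \] Let $k=2^m$ with $0\le m\le n-1$. Let $T_k = I^{\otimes (n-m-1)} \otimes X \otimes I^{\otimes m}$ (where $X$ is the Pauli $X$ matrix and $I$ the $2\times 2$ identity), let $P$ be the $N\times N$ permutation matrix (so $P^{-1}=P^T$) acting as the cyclic decrement $P\ket{i}=\ket{(i-1)\bmod N}$, and let $E_k$ be the $N\times N$ matrix obtained from $T_k$ by setting its bottom-right $2k\times 2k$ submatrix to zero, i.e. (with $0$-based indices) $(E_k)_{i,j}=(T_k)_{i,j}$ if $i< N-2k$ or $j< N-2k$, and $(E_k)_{i,j}=0$ if $i\ge N-2k$ and $j\ge N-2k$. Then \[ M_k = \begin{cases} a_k\left(T_k + P^{-k}E_kP^{k}\right) & \text{if } m<n-1,\\ a_k T_k & \text{if } m=n-1.\end{cases} \]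
   Context: Computational basis states $\ket{i}$, $i\in\{0,\dots,N-1\}$, of $n$ qubits are identified with $\ket{i_n i_{n-1}\cdots i_1}$ where $i=\sum_{l=1}^n i_l 2^{l-1}$, the leftmost tensor factor corresponding to the most significant bit $i_n$. Thus $T_k$ flips the bit of weight $2^m$. *)

(* Defs.v *)
From mathcomp Require Import all_boot all_order all_algebra.
Set Implicit Arguments. Unset Strict Implicit. Unset Printing Implicit Defensive.
Import GRing.Theory.
Local Open Scope ring_scope.

Lemma kron_divP p q (i : 'I_(p * q)) : (i %/ q < p)%N.
Proof.
case: q i => [|q] [i Hi] /=; first by rewrite muln0 in Hi.
by rewrite ltn_divLR.
Qed.

Lemma kron_modP p q (i : 'I_(p * q)) : (i %% q < q)%N.
Proof.
case: q i => [|q] [i Hi] /=; first by rewrite muln0 in Hi.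
by rewrite ltn_mod.
Qed.

(* Kronecker (tensor) product A (x) B; the left factor carries the most
   significant part of the index (convention of the paper). *)
Definition kron (R : pzRingType) p q (A : 'M[R]_p) (B : 'M[R]_q) : 'M[R]_(p * q) :=
  \matrix_(i, j) (A (Ordinal (kron_divP i)) (Ordinal (kron_divP j)) *
                  B (Ordinal (kron_modP i)) (Ordinal (kron_modP j))).

Definition pauliX (R : pzRingType) : 'M[R]_2 := \matrix_(i, j) (i != j)%:R.

(* T_k = I^{(n-m-1)} (x) X (x) I^{m}, with k = 2^m (I^{(r)} = identity of size 2^r);
   viewed as an N x N matrix, N = 2^n (dimensions agree when m < n;
   conform_mx returns the matrix itself when dimensions agree). *)
Definition Tmat (R : pzRingType) (n m : nat) : 'M[R]_(2 ^ n) :=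
  conform_mx (0 : 'M[R]_(2 ^ n))
    (kron (kron (1%:M : 'M[R]_(2 ^ (n - m - 1))) (pauliX R)) (1%:M : 'M[R]_(2 ^ m))).

Definition ket (R : pzRingType) (N i : nat) : 'cV[R]_N := \col_(r < N) ((r : nat) == i)%:R.

Definition Mk (R : pzRingType) (n : nat) (a : nat -> R) (k : nat) : 'M[R]_(2 ^ n) :=
  a k *: \sum_(0 <= i < 2 ^ n - k)
          (ket R (2 ^ n) i *m (ket R (2 ^ n) (i + k))^T
           + ket R (2 ^ n) (i + k) *m (ket R (2 ^ n) i)^T).

Definition Pmat (R : pzRingType) (n : nat) : 'M[R]_(2 ^ n) :=
  \matrix_(r, c) ((r : nat) == (((c : nat) + 2 ^ n - 1) %% 2 ^ n)%N)%:R.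

Definition Emat (R : pzRingType) (n m : nat) : 'M[R]_(2 ^ n) :=
  \matrix_(i, j) (if ((i : nat) < 2 ^ n - 2 * 2 ^ m)%N || ((j : nat) < 2 ^ n - 2 * 2 ^ m)%N
                  then Tmat R n m i j else 0).

(* Main.v *)
(* A pair (i, i + k) with k = 2^m and i + k < N is an edge of the flip T_k
   exactly when bit m of i is 0.  When bit m of i is 1, bit m of i - k is 0, so
   (i - k, i) is an edge of T_k; conjugating by P^k translates indices by k and
   recovers (i, i + k).  The translation is cyclic, and the edges of T_k that it
   would wrap around are those inside the last block of size
   2k, which E_k removes. *)
Require Import Defs.
From mathcomp Require Import all_boot all_order all_algebra.
From mathcomp Require Import fingroup perm zify.
Import GRing.Theory.
Local Open Scope ring_scope.

(* For k = 2^m: j is i with its bit m switched from 0 to 1. *)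
Definition bit_set_by (k i j : nat) : bool := (j == i + k)%N && ~~ odd (i %/ k).

(** The left side is what an entry of the Kronecker product tests: equal high parts, different
    middle bits, equal low parts. By uniqueness of Euclidean division the indices then differ by
    [k], upwards from the one whose bit is 0. *)
Lemma bit_set_byE {k} i j : (0 < k)%N ->
  [&& i %/ k %/ 2 == j %/ k %/ 2, i %/ k %% 2 != j %/ k %% 2 & i %% k == j %% k]%N
  = bit_set_by k i j || bit_set_by k j i.
Proof.
move=> k0; rewrite /bit_set_by.
have Ei := divn_eq i k; have Ej := divn_eq j k.
have := ltn_pmod i k0; have := ltn_pmod j k0.
move: (i %/ k)%N (j %/ k)%N (i %% k)%N (j %% k)%N Ei Ej => u v s t -> -> tk sk.
have shift x y w z : (w < k)%N -> (z < k)%N ->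
    (y * k + z == x * k + w + k)%N = (y == x.+1) && (w == z).
  move=> wk zk; rewrite -addnA [(w + k)%N]addnC addnA -mulSnr.
  apply/eqP/andP => [e|[/eqP-> /eqP->] //].
  have := congr1 (divn^~ k) e; rewrite !divnMDl // !divn_small // !addn0 => yx.
  by move: e; rewrite yx => /addnI ->; rewrite !eqxx.
rewrite !shift // [t == s]eq_sym; case: (s == t); rewrite ?andbT ?andbF //.
by lia.
Qed.

Lemma bit_set_by_asym {k} i j : (0 < k)%N -> bit_set_by k i j -> ~~ bit_set_by k j i.
Proof. by rewrite /bit_set_by => k0; lia. Qed.

(** One direction of the entrywise identity behind the theorem. If [r + k] does not wrap, adding [k]
    flips the parity of the quotient, so at most one term counts. For [c = r + k], the guard coming
    from [E_k] says exactly that [c + k] does not wrap. *)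
Lemma eq_addn_bit_set_by {k q r c} : (0 < k)%N -> let N := (q * (2 * k))%N in
  (r < N)%N -> (c < N)%N ->
  let i := ((r + k) %% N)%N in let j := ((c + k) %% N)%N in
  (j == i + k)%N =
  (bit_set_by k i j + (((r < N - 2 * k) || (c < N - 2 * k)) && bit_set_by k r c))%N :> nat.
Proof.
move=> k0 N rN cN i j; rewrite /bit_set_by.
have q0 : (0 < q)%N by case: q @N rN {cN i j}.
have kN : (2 * k <= N)%N by rewrite leq_pmull.
have modE x : (x < N)%N -> ((x + k) %% N = if x + k < N then x + k else x + k - N)%N.
  move=> xN; case: ltnP => h; first by rewrite modn_small.
  by rewrite -{1}(subnK h) modnDr modn_small //; lia.
have [h|h] := ltnP (r + k) N.
  have -> : i = (r + k)%N by rewrite /i modE // h.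
  rewrite divnDr // divnn k0 addn1 /= /j modE //.
  by case: (odd _); case: ltnP => h'; lia.
(* Here [r + k] wraps: [i] has quotient 0, and [c = r + k] is impossible since [c < N]. *)
have ik : (i < k)%N by rewrite /i modE // (ltnNge (r + k)) h /=; lia.
by rewrite divn_small //= andbT; lia.
Qed.

Lemma conform_mxE {R : nmodType} {p q} (e : q = p) (A : 'M[R]_p) (B : 'M[R]_q) i j :
  conform_mx B A i j = A (cast_ord e i) (cast_ord e j).
Proof. by case: _ / e A => A; rewrite conform_mx_id !cast_ord_id. Qed.

Lemma TmatE (R : pzRingType) n m i j : (m < n)%N ->
  Tmat R n m i j = (bit_set_by (2 ^ m) i j)%:R + (bit_set_by (2 ^ m) j i)%:R.
Proof.
move=> mn; have k0 : (0 < 2 ^ m)%N by rewrite expn_gt0.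
have e : (2 ^ n = 2 ^ (n - m - 1) * 2 * 2 ^ m)%N.
  by rewrite -expnSr -expnD; congr expn; lia.
rewrite /Tmat (conform_mxE e) !mxE /= -!val_eqE /= -!natrM !mulnb -andbA.
rewrite -[LHS]/(_ %:R) bit_set_byE // -natrD; congr _%:R.
(* The two alternatives exclude each other, so their disjunction becomes a sum. *)
by have := bit_set_by_asym i j k0; do 2!case: bit_set_by => //; move=> /(_ isT).
Qed.

Lemma MkE (R : pzRingType) n (a : nat -> R) k i j :
  Mk n a k i j = a k * (((j : nat) == i + k)%N%:R + ((i : nat) == j + k)%N%:R).
Proof.
rewrite mxE; congr (_ * _); rewrite summxE.
under eq_bigr => l _ do rewrite !mxE !big_ord1 !mxE -!natrM !mulnb.
have one (x y : 'I_(2 ^ n)) : \sum_(0 <= l < 2 ^ n - k)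
    (((x : nat) == l) && ((y : nat) == l + k)%N)%:R = ((y : nat) == x + k)%N%:R :> R.
  have [xk|xk] := ltnP x (2 ^ n - k).
    rewrite (bigD1_seq (x : nat)) ?iota_uniq ?mem_index_iota //= eqxx big1 ?addr0 //.
    by move=> l /negPf; rewrite eq_sym => ->.
  (* No summand selects such an [x], and [x + k] would exceed every column index. *)
  rewrite big_nat big1 => [|l /= lk]; last by case: eqP => // xl; lia.
  by case: eqP => // e; have := ltn_ord y; lia.
by rewrite big_split /= one; under eq_bigr => l _ do rewrite andbC; rewrite one.
Qed.

Section CyclicShift.

Variable N : nat.

Lemma addn_mod_proof k (i : 'I_N) : ((i + k) %% N < N)%N.
Proof. by rewrite ltn_mod (leq_ltn_trans _ (ltn_ord i)). Qed.

Definition cyclic_add (k : nat) (i : 'I_N) := Ordinal (addn_mod_proof k i).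

Lemma cyclic_add_inj k : injective (cyclic_add k).
Proof.
move=> i j /(congr1 val) /= /eqP; rewrite eqn_modDr !modn_small // => /eqP.
exact: val_inj.
Qed.

Definition cyclic_perm k : 'S_N := perm (@cyclic_add_inj k).

End CyclicShift.

(** [perm_mx s] has its 1 of row [i] in column [s i], so the decrement of kets is the matrix of the
    increment of indices. *)
Lemma Pmat_exp (R : pzRingType) n k : Pmat R n ^+ k = perm_mx (cyclic_perm (2 ^ n) k).
Proof.
elim: k => [|k IHk].
  rewrite -[LHS]/(1%:M) -perm_mx1; congr perm_mx; apply/permP => i.
  by rewrite perm1 permE; apply: val_inj; rewrite /= addn0 modn_small.
have -> : cyclic_perm (2 ^ n) k.+1 = (cyclic_perm (2 ^ n) 1 * cyclic_perm (2 ^ n) k)%g.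
  apply/permP => i; rewrite permM !permE; apply: val_inj => /=.
  by rewrite modnDml -addnA add1n.
rewrite exprS IHk perm_mxM; congr (_ *m _).
apply/matrixP => i j; rewrite !mxE permE; congr _%:R; congr nat_of_bool.
rewrite -val_eqE /=; have iN := ltn_ord i; have jN := ltn_ord j.
have N0 : (0 < 2 ^ n)%N by rewrite expn_gt0.
rewrite -[X in X == _](modn_small iN).
(* Adding 1 on both sides modulo [2 ^ n] cancels the truncated subtraction in [Pmat]. *)
rewrite -(eqn_modDr 1) subnK; last by rewrite addn_gt0 N0 orbT.
by rewrite modnDr (modn_small jN).
Qed.

(* Stated at translated indices, so that the inverse permutation does not appear. *)
Lemma Pmat_conj (R : comUnitRingType) n k (A : 'M[R]_(2 ^ n)) r c :
  (invmx (Pmat R n ^+ k) *m A *m Pmat R n ^+ k)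
    (cyclic_perm (2 ^ n) k r) (cyclic_perm (2 ^ n) k c) = A r c.
Proof.
rewrite Pmat_exp; set s := cyclic_perm _ _.
have -> : invmx (perm_mx s) = perm_mx s^-1 :> 'M[R]_(2 ^ n).
  rewrite -[LHS]mulmx1 -perm_mx1 -(mulgV s) perm_mxM mulKmx //.
  exact: unitmx_perm.
by rewrite -{2}[s]invgK -col_permE -row_permE !mxE !permK.
Qed.

Theorem theorem1 (R : comUnitRingType) (n m : nat) (a : nat -> R) :
  (1 <= n)%N -> (m <= n - 1)%N ->
  Mk n a (2 ^ m)%N =
  (if (m < n - 1)%N then
     a (2 ^ m)%N *: (Tmat R n m
                   + invmx (Pmat R n ^+ (2 ^ m)%N) *m Emat R n m *m Pmat R n ^+ (2 ^ m)%N)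
   else a (2 ^ m)%N *: Tmat R n m).
Proof.
move=> n1 mn1; have mn : (m < n)%N by lia.
have k0 : (0 < 2 ^ m)%N by rewrite expn_gt0.
case: ifP => [_|mlt]; apply/matrixP => i j.
  have NE : (2 ^ n = 2 ^ (n - m - 1) * (2 * 2 ^ m))%N.
    by rewrite -expnS -expnD; congr expn; lia.
  pose s := cyclic_perm (2 ^ n) (2 ^ m).
  (* Every index is a translate by [k], so it suffices to compare entries at translates of [r] and
     [c]. *)
  rewrite -[i](permKV s) -[j](permKV s); move: (_ i) (_ j) => r c.
  have ltN (x : 'I_(2 ^ n)) : (x < 2 ^ (n - m - 1) * (2 * 2 ^ m))%N by rewrite -NE.
  rewrite MkE [RHS]mxE [X in _ = _ * X]mxE Pmat_conj TmatE // [Emat _ _ _ _ _]mxE TmatE //.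
  congr (_ * _); rewrite !permE /=.
  have e1 := eq_addn_bit_set_by k0 (ltN r) (ltN c).
  have e2 := eq_addn_bit_set_by k0 (ltN c) (ltN r).
  rewrite -NE /= in e1 e2; rewrite e1 e2 !natrD [in X in _ + X]orbC.
  by case: (_ || _); rewrite ?addr0 // addrACA.
rewrite MkE [RHS]mxE TmatE //; congr (_ * _).
have NE : (2 ^ n = 2 * 2 ^ m)%N by rewrite -expnS; congr expn; lia.
(* Now [N = 2k], so [x + k < N] already forces bit [m] of [x] to be 0, and [T_k] has all the
   edges. *)
have low (x y : 'I_(2 ^ n)) :
    ((y : nat) == x + 2 ^ m)%N = bit_set_by (2 ^ m) x y.
  rewrite /bit_set_by; case: eqP => //= e.
  by rewrite divn_small //; have := ltn_ord y; lia.
by rewrite !low.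
Qed.
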